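(* Let $G=(V,E)$ be an undirected bipartite graph, whose edges may be weighted, with fixed bipartition $V=L\cup R$, $n=|V|$ vertices and maximum degree $\Delta$. Let $(S,T)$, with $S\subseteq L$ and $T\subseteq R$, be a subgraph such that $d(S,T)\ge 2\theta$. Then there exists a set $S_\theta\subseteq S$ with the following properties. 1. $e(S_\theta,T)\ge e(S,T)/2$. 2. If $v\in S_\theta$ and $K\ge\max(|S|,|T|)$, then the algorithm LocalDensity$(v,K)$ (defined in the context) outputs a subgraph $(X,Y)$ such that $$d(X,Y)\ \ge\ \frac{\theta}{8\log (16\Delta K)}\ =\ \Omega\!\left(\frac{\theta}{\log n}\right).$$
   Context: Logarithms are base 2. $\|\cdot\|$ is the Euclidean norm, $\langle\cdot,\cdot\rangle$ the standard inner product, and vectors are row vectors indexed by $V$. $A$ is the adjacency matrix of $G$; if the edges are weighted, $A_{u,v}$ is the weight of the edge $\{u,v\}$. For sets of vertices $S,T$ on opposite sides of the bipartition, $(S,T)$ denotes the induced bipartite subgraph on $S\cup T$, $e(S,T)=\langle 1_SA,1_T\rangle$ is the sum of the weights of the edges between $S$ and $T$ (where $1_S$ is the indicator vector of $S$), and the density is $d(S,T)=\frac{e(S,T)}{\sqrt{|S|}\sqrt{|T|}}$. For a vector $z$, $\mathrm{round}(z)$ is obtained by rounding each nonzero entry up to the nearest power of 2, that is, replacing $z(u)$ by $2^i$ where $i$ is the smallest integer with $2^i\ge z(u)$; zero entries stay zero. For $\epsilon\ge0$, $\mathrm{prune}_\epsilon(z)$ is obtained from $z$ by setting to zero every entry with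 $z(u)\le\epsilon\|z\|$ and leaving the other entries unchanged. Pruned growth process: given a starting vector $x_0$ with entries in $\{0,1\}$ and real numbers $\epsilon_t\in[0,1]$, define $x_{t+1}=\mathrm{prune}_{\epsilon_{t+1}}(\mathrm{round}(x_tA))$. Let $X^t_i$ be the set of vertices $v$ with $x_t(v)=2^i$, and $Y^t_i$ the set of vertices $v$ with $\mathrm{round}(x_tA)(v)=2^i$. Algorithm LocalDensity$(v,K)$, for a starting vertex $v$ and a target size $K$: let $x_0=1_{\{v\}}$, $\tau=\lceil\log\sqrt{2K}\rceil$, and $\epsilon_t=\frac{2^{t}}{8K}$. Compute the vectors $x_0,\dots,x_\tau$ of the pruned growth process. Compute $d(X^t_i,Y^t_j)$ for each pair $i,j$ (with both sets nonempty) and each time $t<\tau$. Output the subgraph $(X^t_i,Y^t_j)$ with the highest density.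
   Formalization: The clause ''= Ω(θ/log n)'' is stated for θ ≥ 0 and K ≤ n, since it fails for unbounded K (single edge, n = 2, K → ∞); edge weights are taken positive and Δ counts incident edges. The main bound holds for every K ≥ max(|S|,|T|). *)

(* Defs.v *)
From HB Require Import structures.
From mathcomp Require Import all_boot all_order all_algebra.
From mathcomp Require Import reals exp.

Set Implicit Arguments.
Unset Strict Implicit.
Unset Printing Implicit Defensive.

Import Order.TTheory GRing.Theory Num.Theory.

Local Open Scope ring_scope.

Definition log2 (R : realType) (x : R) : R := ln x / ln 2.

(* The bipartition is (left, ~: left). The entries of the adjacency matrix are
   positive exactly on the edges, so an unweighted graph is the case
   weight u v = (adj u v)%:R. *)
Record bipartite_graph (R : realType) (V : finType) := BipartiteGraph {
  left : {set V};
  adj : rel V;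
  weight : V -> V -> R;
  adj_sym : symmetric adj;
  adj_bipartite : forall u v, adj u v -> (u \in left) != (v \in left);
  weight_sym : forall u v, weight u v = weight v u;
  weight_gt0 : forall u v, adj u v -> 0 < weight u v;
  weight_nonadj : forall u v, ~~ adj u v -> weight u v = 0
}.

Definition right (R : realType) (V : finType) (G : bipartite_graph R V) :
  {set V} := ~: left G.

(* The degree of a vertex is its number of incident edges, also when the edges
   are weighted. *)
Definition max_degree (R : realType) (V : finType) (G : bipartite_graph R V) :
  nat := \max_(v : V) #|[set u | adj G v u]|.

Section Vectors.
Variables (R : realType) (V : finType).
Implicit Types (x z : V -> R) (S T : {set V}) (G : bipartite_graph R V).

Definition indic S : V -> R := fun v => (v \in S)%:R.

Definition inner x z : R := \sum_v x v * z v.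

Definition norm x : R := Num.sqrt (inner x x).

Definition mulA G x : V -> R := fun v => \sum_u x u * weight G u v.

Definition edge_weight G S T : R := inner (mulA G (indic S)) (indic T).

Definition density G S T : R :=
  edge_weight G S T / (Num.sqrt #|S|%:R * Num.sqrt #|T|%:R).

(* For a > 0 this is the smallest integer i with a <= 2 ^ i; see
   round_expP. The exponent may be negative. *)
Definition round_exp (a : R) : int := Num.ceil (log2 a).

Definition round z : V -> R :=
  fun u => if z u == 0 then 0 else 2 ^ round_exp (z u).

Definition prune (eps : R) z : V -> R :=
  fun u => if z u <= eps * norm z then 0 else z u.

(* eps 0 is not used. *)
Fixpoint pruned_growth G (eps : nat -> R) (x0 : V -> R) (t : nat) : V -> R :=
  if t is t'.+1 then
    prune (eps t'.+1) (round (mulA G (pruned_growth G eps x0 t')))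
  else x0.

Definition level_set z (i : int) : {set V} := [set v | z v == 2 ^ i].

End Vectors.

Section LocalDensity.
Variables (R : realType) (V : finType) (G : bipartite_graph R V).
Variables (v : V) (K : R).

Definition ld_tau : int := Num.ceil (log2 (Num.sqrt (2 * K))).

Definition ld_eps (t : nat) : R := 2 ^+ t / (8 * K).

Definition ld_x (t : nat) : V -> R := pruned_growth G ld_eps (indic R [set v]) t.

Definition ld_X (t : nat) (i : int) : {set V} := level_set (ld_x t) i.

Definition ld_Y (t : nat) (j : int) : {set V} :=
  level_set (round (mulA G (ld_x t))) j.

Definition ld_candidate (X Y : {set V}) : Prop :=
  exists (t : nat) (i j : int),
    [/\ t%:Z < ld_tau, X = ld_X t i, Y = ld_Y t j, X != set0 & Y != set0].

(* A relation, because ties for the highest density may be broken arbitrarily. *)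
Definition local_density_output (X Y : {set V}) : Prop :=
  ld_candidate X Y /\
  forall X' Y', ld_candidate X' Y' -> density G X' Y' <= density G X Y.

End LocalDensity.

Lemma round_expP (R : realType) (a : R) : 0 < a ->
  a <= 2 ^ round_exp a /\ forall i : int, a <= 2 ^ i -> round_exp a <= i.
Proof.
move=> a0; have l2 : 0 < ln (2 : R) by rewrite ln_gt0 // ltr1n.
have key (i : int) : (a <= 2 ^ i) = (round_exp a <= i).
  rewrite -powR_intmul ?ler0n // -ler_ln ?posrE ?powR_gt0 ?ltr0n // ln_powR.
  by rewrite -ler_pdivrMr // /round_exp ceil_le_int.
by split=> [|i]; rewrite key.
Qed.

(* Main.v *)
(* Suppose that every pair of level sets examined by the algorithm has density
   at most D = theta / (8 L), with L = log2 (16 Delta K). Up to a factor 2 from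
   rounding, the squared norm of z = round (x A) is <x A, z>, a sum over the
   pairs of levels of x and z. Pruning leaves at most L levels in x, and all but
   a quarter of the squared norm of z lies on its L highest levels, so by
   Cauchy-Schwarz one step multiplies the norm of x by at most theta / 3.
   Conversely, if e(B, T) >= e(S, T) / 2 for some B included in S, then the
   top singular value of the adjacency matrix of (B, T) is at least theta, and
   a vertex v of B where the top singular vector is largest starts a process
   whose correlation with the singular vectors grows by theta at each step, up
   to pruning losses summing to a constant factor. For such v this contradicts
   the upper bound at time tau. So the set of all v in S admitting such vectors
   carries at least half of the weight between S and T. *)
Require Import Defs.
From HB Require Import structures.
From mathcomp Require Import all_boot all_order all_algebra.
From mathcomp Require Import ring lra.
From mathcomp Require Import boolp.
From mathcomp Require classical_sets topology normedtype derive.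
From mathcomp Require Import reals exp.

Set Implicit Arguments.
Unset Strict Implicit.
Unset Printing Implicit Defensive.

Import Order.TTheory GRing.Theory Num.Theory.
Import Defs.

Local Open Scope ring_scope.

(** * Inner products, norms and the Cauchy-Schwarz inequality *)

Section Inner.
Variables (R : realType) (V : finType).
Implicit Types (a b x y z : V -> R) (N : V -> V -> R).

Lemma innerC x y : inner x y = inner y x.
Proof. by apply: eq_bigr => u _; rewrite mulrC. Qed.

Lemma inner_self_ge0 x : 0 <= inner x x.
Proof. by apply: sumr_ge0 => u _; rewrite -expr2 sqr_ge0. Qed.

Lemma inner_self_eq0 x : inner x x = 0 -> forall u, x u = 0.
Proof.
move=> /eqP; rewrite psumr_eq0 => [/allP x0 u|u _]; last first.
  by rewrite -expr2 sqr_ge0.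
have /= := x0 u (mem_index_enum u).
by rewrite mulf_eq0 orbb => /eqP.
Qed.

Lemma ler_inner x y z : (forall u, 0 <= x u) -> (forall u, y u <= z u) ->
  inner x y <= inner x z.
Proof. by move=> x0 yz; apply: ler_sum => u _; rewrite ler_wpM2l. Qed.

Lemma inner_subZ c x y : inner (fun u => x u - c * y u) (fun u => x u - c * y u)
  = inner x x - c * inner x y *+ 2 + c ^+ 2 * inner y y.
Proof.
rewrite /inner mulr_sumr mulr_sumr -sumrMnl -sumrB -big_split /=.
by apply: eq_bigr => u _; ring.
Qed.

Lemma innerZr c x y : inner x (fun u => c * y u) = c * inner x y.
Proof. by rewrite /inner mulr_sumr; apply: eq_bigr => u _; rewrite mulrCA. Qed.

Lemma innerZ c x : inner (fun u => c * x u) (fun u => c * x u)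
  = c ^+ 2 * inner x x.
Proof. by rewrite innerZr innerC innerZr mulrA. Qed.

Lemma cauchy_schwarz x y : inner x y ^+ 2 <= inner x x * inner y y.
Proof.
have [y0|yN0] := eqVneq (inner y y) 0.
  rewrite y0 mulr0 [inner x y]big1 ?expr0n // => u _.
  by rewrite (inner_self_eq0 y0) mulr0.
have yp : 0 < inner y y by rewrite lt_neqAle eq_sym yN0 inner_self_ge0.
(* The vector is [x] minus its projection on [y]. *)
have := inner_self_ge0 (fun u => x u - inner x y / inner y y * y u).
rewrite inner_subZ -(pmulr_lge0 _ yp).
move=> h; rewrite -subr_ge0; move: h => /le_trans; apply.
by rewrite le_eqVlt; apply/orP; left; apply/eqP; field.
Qed.

Lemma norm_ge0 x : 0 <= norm x.
Proof. exact: sqrtr_ge0. Qed.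

Lemma sqr_norm x : norm x ^+ 2 = inner x x.
Proof. by rewrite sqr_sqrtr // inner_self_ge0. Qed.

Lemma ler_norm_inner x y : inner x x <= inner y y -> norm x <= norm y.
Proof. exact: ler_wsqrtr. Qed.

Lemma ler_entry_norm x u : x u <= norm x.
Proof.
apply: le_trans (ler_norm _) _; rewrite -sqrtr_sqr; apply: ler_wsqrtr.
rewrite expr2 /inner (bigD1 u) //= lerDl.
by apply: sumr_ge0 => w _; rewrite -expr2 sqr_ge0.
Qed.

Lemma inner_le_norm x y : inner x y <= norm x * norm y.
Proof.
apply: le_trans (ler_norm _) _; rewrite -sqrtr_sqr -sqrtrM ?inner_self_ge0 //.
exact/ler_wsqrtr/cauchy_schwarz.
Qed.

Lemma inner_indicr x (S : {set V}) : inner x (indic R S) = \sum_(u in S) x u.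
Proof.
rewrite [RHS]big_mkcond; apply: eq_bigr => u _.
by rewrite /indic; case: ifP => _; rewrite ?mulr1 ?mulr0.
Qed.

Lemma inner_indic (S : {set V}) : inner (indic R S) (indic R S) = #|S|%:R.
Proof.
rewrite inner_indicr -sum1_card natr_sum; apply: eq_bigr => u uS.
by rewrite /indic uS.
Qed.

Lemma sqr_sum_le x (S : {set V}) : inner x x <= 1 ->
  (forall u, u \notin S -> x u = 0) -> (\sum_u x u) ^+ 2 <= #|S|%:R.
Proof.
move=> x1 xS; have -> : \sum_u x u = inner x (indic R S).
  rewrite inner_indicr [RHS]big_mkcond; apply: eq_bigr => u _.
  by case: ifPn => // /xS.
apply: le_trans (cauchy_schwarz _ _) _; rewrite inner_indic.
by rewrite ler_piMl.
Qed.

(** Testing against [x] divided by its norm gives [norm x <= s]. *)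
Lemma inner_self_le x s : 0 <= s ->
  (forall y, inner y y <= 1 -> inner x y <= s) -> inner x x <= s ^+ 2.
Proof.
move=> s0 xs; have [x0|xN0] := eqVneq (norm x) 0.
  by rewrite -sqr_norm x0 expr0n sqr_ge0.
rewrite -sqr_norm lerXn2r ?nnegrE ?norm_ge0 //.
have := xs (fun u => (norm x)^-1 * x u); rewrite innerZ innerZr -sqr_norm.
by rewrite -exprMn mulVf // expr1n expr2 mulKf // => /(_ (lexx 1)).
Qed.

Definition vecmul N x : V -> R := fun w => \sum_u x u * N u w.

Lemma vecmul_adjoint N x y :
  inner (vecmul N x) y = inner x (vecmul (fun u w => N w u) y).
Proof.
rewrite /inner /vecmul.
under eq_bigr do rewrite mulr_suml.
rewrite exchange_big /=; apply: eq_bigr => u _; rewrite mulr_sumr.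
by apply: eq_bigr => w _; rewrite -mulrA (mulrC (y w)).
Qed.

End Inner.

(** * Top singular vectors, obtained by compactness *)

Section TopSingularVectors.
Variables (R : realType) (V : finType).
Import classical_sets topology normedtype derive numFieldNormedType.Exports.
Local Open Scope classical_set_scope.

(** The topology is that of row vectors, so functions on [V] are read through the enumeration of
    [V]. *)
Let coord (x : 'rV[R]_#|V|) : V -> R := fun u => x ord0 (enum_rank u).

Let coordK (x : V -> R) : coord (\row_i x (enum_val i)) = x.
Proof. by apply/funext => u; rewrite /coord mxE enum_rankK. Qed.

Let coord_cont u : continuous (fun x => coord x u).
Proof. exact: coord_continuous. Qed.

Let cont_comp (T : topologicalType) (g : T -> 'rV[R]_#|V|) u :
  continuous g -> continuous (fun p => coord (g p) u).
Proof. by move=> cg p; exact: (cvg_comp _ _ (cg p) (@coord_cont u (g p))). Qed.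

Let cont_mul (T : topologicalType) (f g : T -> R) :
  continuous f -> continuous g -> continuous (fun p => f p * g p).
Proof. by move=> cf cg p; apply: cvgM; [exact: cf | exact: cg]. Qed.

Let cont_sum (T : topologicalType) (f : V -> T -> R) :
  (forall u, continuous (f u)) -> continuous (fun p => \sum_u f u p).
Proof.
by move=> cf; apply: continuous_big => [|u _]; [exact: add_continuous|exact: cf].
Qed.

(** Heine-Borel: the ball is the preimage of a closed half-line under a continuous map, and the
    matrix norm, a maximum of absolute entries, is at most the Euclidean one. *)
Let ball_compact : compact [set x | inner (coord x) (coord x) <= 1].
Proof.
apply: bounded_closed_compact; last first.
  apply: (@closed_comp _ _ (fun x => inner (coord x) (coord x))
                           [set r : R | r <= 1]); last exact: closed_le.
  move=> x _; move: x; apply: cont_sum => u.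
  by apply: cont_mul; exact: coord_cont.
exists 1; split => // M M1 x /= x1; rewrite /Num.norm /= mx_normrE.
apply: bigmax_le => [|[i j] _ /=]; first exact: le_trans (ltW M1).
apply: le_trans (ltW M1); rewrite ord1 -(expr_le1 (n := 2)) // real_normK ?num_real //.
apply: le_trans x1; rewrite /inner (bigD1 (enum_val j)) //= /coord enum_valK.
rewrite -expr2 lerDl.
by apply: sumr_ge0 => w _; rewrite -expr2 sqr_ge0.
Qed.

(* A maximizing pair of the bilinear form over two unit balls: each vector
   attains equality in Cauchy-Schwarz against the image of the other. *)
Lemma exists_top_singular_vectors (N : V -> V -> R) :
  exists psi phi : V -> R, let sigma := inner (vecmul N psi) phi in
  [/\ inner psi psi <= 1, inner phi phi <= 1,
      (forall w, vecmul N psi w = sigma * phi w),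
      (forall u, vecmul (fun u w => N w u) phi u = sigma * psi u)
    & forall a b, inner a a <= 1 -> inner b b <= 1 ->
        inner (vecmul N a) b <= sigma].
Proof.
pose B := [set x | inner (coord x) (coord x) <= 1].
pose F (p : 'rV[R]_#|V| * 'rV[R]_#|V|) := inner (vecmul N (coord p.1)) (coord p.2).
have cF : {within B `*` B, continuous F}.
  apply: continuous_subspaceT; apply: cont_sum => w; apply: cont_mul.
    apply: cont_sum => u; apply: cont_mul; last exact: cst_continuous.
    by apply: cont_comp => p; exact: cvg_fst.
  by apply: cont_comp => p; exact: cvg_snd.
have B0 : (B `*` B) !=set0.
  by exists (0, 0); split; rewrite /B /= /inner big1 // => u _;
     rewrite /coord mxE mul0r.
have [[x y] /set_mem [/= x1 y1] maxF] :=
  compact_EVT_max B0 (compact_setX ball_compact ball_compact) cF.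
pose s := F (x, y).
have smax a b : inner a a <= 1 -> inner b b <= 1 -> inner (vecmul N a) b <= s.
  move=> a1 b1.
  have := maxF (\row_i a (enum_val i), \row_i b (enum_val i)).
  rewrite /F /= !coordK; apply; apply/mem_set.
  by split; rewrite /B /= coordK.
have s0 : 0 <= s.
  have z1 : inner (fun _ : V => 0 : R) (fun=> 0) <= 1.
    by rewrite /inner big1 // => u _; rewrite mul0r.
  apply: le_trans (smax _ _ z1 z1); rewrite /inner big1 // => u _.
  by rewrite mulr0.
(* Since [|a| <= s] and [|b| <= 1], the squared norm of [a - s b] is at most
   [s^2 - 2 s^2 + s^2 = 0]. *)
have eig (a b : V -> R) : inner b b <= 1 -> inner a b = s ->
    (forall c, inner c c <= 1 -> inner a c <= s) -> forall u, a u = s * b u.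
  move=> b1 abs amax u; apply/eqP; rewrite -subr_eq0; apply/eqP.
  apply: (inner_self_eq0 (x := fun u => a u - s * b u)).
  apply/eqP; rewrite eq_le inner_self_ge0 andbT inner_subZ abs.
  have := inner_self_le s0 amax; have := ler_wpM2l (sqr_ge0 s) b1; lra.
exists (coord x), (coord y); split => //.
- by apply: eig => // c c1; exact: smax.
- apply: eig => // [|c c1]; first by rewrite innerC -vecmul_adjoint.
  by rewrite innerC -vecmul_adjoint; exact: smax.
Qed.

End TopSingularVectors.

(** * Test vectors that force the process to grow *)

Section Witness.
Variables (R : realType) (V : finType) (G : bipartite_graph R V).
Implicit Types (x y : V -> R) (S T B : {set V}).

Lemma weight_ge0 u v : 0 <= weight G u v.
Proof.
have [uv|uv] := boolP (adj G u v); first exact/ltW/weight_gt0.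
by rewrite weight_nonadj.
Qed.

Lemma mulA_ge0 x : (forall u, 0 <= x u) -> forall u, 0 <= mulA G x u.
Proof. by move=> x0 u; apply: sumr_ge0 => w _; rewrite mulr_ge0 ?weight_ge0. Qed.

Lemma inner_mulA_sym x y : inner (mulA G x) y = inner x (mulA G y).
Proof.
rewrite [LHS](vecmul_adjoint (weight G)); apply: eq_bigr => u _; congr (_ * _).
by apply: eq_bigr => w _; rewrite weight_sym.
Qed.

Lemma edge_weightE S T : edge_weight G S T = \sum_(u in S) \sum_(w in T) weight G u w.
Proof.
rewrite /edge_weight inner_mulA_sym innerC inner_indicr.
apply: eq_bigr => u uS; rewrite [RHS]big_mkcond; apply: eq_bigr => w _.
by rewrite /indic weight_sym; case: ifP; rewrite ?mul0r ?mul1r.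
Qed.

Lemma edge_weight_ge0 S T : 0 <= edge_weight G S T.
Proof.
by rewrite edge_weightE; do 2!apply: sumr_ge0 => ? _; exact: weight_ge0.
Qed.

(* f alternates between the two top singular vectors; K0 bounds the sizes of
   their supports, whence the third and fourth conditions. *)
Definition growth_witness (theta K0 : R) (v : V) (f : nat -> V -> R) :=
  [/\ forall t u, 0 <= f t u,
      forall t, inner (f t) (f t) <= 1,
      forall t, (\sum_u f t u) ^+ 2 <= K0,
      1 <= K0 * f 0%N v ^+ 2
    & forall t u, theta * f t u <= mulA G (f t.+1) u].

(** The singular vectors of the matrix of edges from [S] to [T] are replaced by their absolute
    values, which is harmless because that matrix is nonnegative. The vertex [v] maximizes [|psi|]
    on [S]. *)
Lemma exists_growth_witness S T (theta K0 : R) :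
    0 < theta -> S != set0 -> T != set0 ->
    #|S|%:R <= K0 -> #|T|%:R <= K0 -> theta <= density G S T ->
  exists2 v, v \in S & exists f, growth_witness theta K0 v f.
Proof.
move=> theta0 S0 T0 SK TK dST.
have sS : 0 < Num.sqrt #|S|%:R :> R by rewrite sqrtr_gt0 ltr0n card_gt0.
have sT : 0 < Num.sqrt #|T|%:R :> R by rewrite sqrtr_gt0 ltr0n card_gt0.
pose N u w : R := ((u \in S) && (w \in T))%:R * weight G u w.
have N0 u w : 0 <= N u w by rewrite mulr_ge0 ?weight_ge0.
have NA u w : N u w <= weight G u w.
  by rewrite ler_piMl ?weight_ge0 //; case: (_ && _).
have [psi [phi]] := exists_top_singular_vectors N.
set s := inner _ phi => -[psi1 phi1 Npsi Nphi smax].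
have ts : theta <= s.
  apply: le_trans dST _.
  (* Normalized indicators are unit vectors on which the bilinear form of [N] takes the value
     [density G S T]. *)
  pose a u := (Num.sqrt #|S|%:R : R)^-1 * indic R S u.
  pose b u := (Num.sqrt #|T|%:R : R)^-1 * indic R T u.
  have aN : inner (vecmul N a) (indic R T)
      = (Num.sqrt #|S|%:R)^-1 * edge_weight G S T.
    rewrite inner_indicr edge_weightE [in RHS]exchange_big mulr_sumr /=.
    apply: eq_bigr => w wT; rewrite mulr_sumr [RHS]big_mkcond.
    apply: eq_bigr => u _ /=; rewrite /a /N /indic wT andbT.
    by case: (u \in S); rewrite /= ?mulr1 ?mul1r ?mulr0 ?mul0r.
  have := smax a b; rewrite !innerZ !inner_indic !exprVn !sqr_sqrtr ?ler0n //.
  rewrite !mulVf ?pnatr_eq0 -?lt0n ?card_gt0 // => /(_ (lexx _) (lexx _)).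
  by rewrite innerZr aN /density invfM mulrA mulrC [X in _ * X]mulrC mulrA.
have s0 : 0 < s by apply: lt_le_trans ts.
have psiE u : psi u = s^-1 * vecmul (fun u w => N w u) phi u.
  by rewrite Nphi mulKf ?gt_eqF.
have phiE u : phi u = s^-1 * vecmul N psi u by rewrite Npsi mulKf ?gt_eqF.
have psi_out u : u \notin S -> psi u = 0.
  move=> /negbTE uS; rewrite psiE [vecmul _ _ _]big1 ?mulr0 // => w _.
  by rewrite /N uS mul0r mulr0.
have phi_out u : u \notin T -> phi u = 0.
  move=> /negbTE uS; rewrite phiE [vecmul _ _ _]big1 ?mulr0 // => w _.
  by rewrite /N uS andbF mul0r mulr0.
(* Pairing [psi] with [s psi], the transpose of [N] applied to [phi], gives [s |psi|^2 = s]. *)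
have psi_norm : inner psi psi = 1.
  have sN0 : s != 0 by rewrite gt_eqF.
  apply: (mulfI sN0).
  by rewrite mulr1 -innerZr [RHS]vecmul_adjoint; apply: eq_bigr => u _; rewrite Nphi.
have [v0 v0S] := set0Pn _ S0.
pose v := [arg max_(v > v0 in S) `|psi v|]%O.
have [vS vmax] : v \in S /\ forall u, u \in S -> `|psi u| <= `|psi v|.
  by rewrite /v; case: arg_maxP.
exists v => //.
exists (fun t u => if odd t then `|phi u| else `|psi u|); split => /=.
- by move=> t u; case: ifP.
- move=> t; rewrite /inner; case: (odd t);
    by under eq_bigr do rewrite -normrM ger0_norm -?expr2 ?sqr_ge0 //.
- move=> t; case: (odd t).
    apply: le_trans TK; apply: sqr_sum_le => [|u /phi_out ->]; last by rewrite normr0.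
    by rewrite /inner; under eq_bigr do rewrite -normrM ger0_norm -?expr2 ?sqr_ge0 //.
  apply: le_trans SK; apply: sqr_sum_le => [|u /psi_out ->]; last by rewrite normr0.
  by rewrite /inner; under eq_bigr do rewrite -normrM ger0_norm -?expr2 ?sqr_ge0 //.
(* [|psi|^2 = 1] is a sum over [S], so over at most [K0] terms, each at most [psi v ^+ 2]. *)
- apply: le_trans (ler_wpM2r (sqr_ge0 _) SK); rewrite -[leLHS]psi_norm -sum1_card.
  rewrite natr_sum mulr_suml [leRHS]big_mkcond; apply: ler_sum => u _.
  case: ifPn => [uS|/psi_out ->]; last by rewrite mul0r.
  by rewrite mul1r -expr2 -real_normK ?num_real // lerXn2r ?nnegrE ?vmax.
(* The triangle inequality gives [s |phi| = |N psi| <= N |psi|], and [N] is entrywise at most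
   [weight G]; even times use the transpose. *)
- move=> t u; case: (odd t) => /=.
    apply: le_trans (ler_wpM2r (normr_ge0 _) ts) _.
    rewrite -{1}(gtr0_norm s0) -normrM -Npsi.
    apply: le_trans (ler_norm_sum _ _ _) _; apply: ler_sum => w _.
    by rewrite normrM (ger0_norm (N0 _ _)) ler_wpM2l.
  apply: le_trans (ler_wpM2r (normr_ge0 _) ts) _.
  rewrite -{1}(gtr0_norm s0) -normrM -Nphi.
  apply: le_trans (ler_norm_sum _ _ _) _; apply: ler_sum => w _.
  by rewrite normrM (ger0_norm (N0 _ _)) ler_wpM2l // weight_sym.
Qed.

End Witness.

(** * Base 2 logarithms and integer powers of 2 *)

Section Log2.
Variable R : realType.
Implicit Types a b : R.

Lemma ln2_gt0 : 0 < ln (2 : R).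
Proof. by rewrite ln_gt0 // ltr1n. Qed.

Lemma log2M a b : 0 < a -> 0 < b -> log2 (a * b) = log2 a + log2 b.
Proof. by move=> a0 b0; rewrite /log2 lnM ?posrE // mulrDl. Qed.

Lemma ler_log2 a b : 0 < a -> a <= b -> log2 a <= log2 b.
Proof.
move=> a0 ab; rewrite ler_pM2r ?invr_gt0 ?ln2_gt0 // ler_ln ?posrE //.
exact: lt_le_trans ab.
Qed.

Lemma log2_2X n : log2 (2 ^+ n) = n%:R :> R.
Proof. by rewrite /log2 lnXn // mulrnAl divff // gt_eqF ?ln2_gt0. Qed.

Lemma log2_ge0 a : 1 <= a -> 0 <= log2 a.
Proof. by move=> a1; rewrite divr_ge0 ?ln_ge0 // ler1n. Qed.

Lemma round_exp_lt a : (round_exp a)%:~R < log2 a + 1.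
Proof. by rewrite -ltrBlDr; have := ceilB1_lt (log2 a); rewrite intrB. Qed.

Lemma exists_exp2_bound a : 1 <= a ->
  exists2 m : nat, a <= 2 ^+ m & m%:R <= log2 a + 1.
Proof.
move=> a1; have a0 : 0 < a by apply: lt_le_trans a1.
have [le_a _] := round_expP a0.
have: 0 <= round_exp a by rewrite /round_exp -(ceil0 R) le_ceil // log2_ge0.
case: (round_exp a) (round_exp_lt a) le_a => // m lt_a le_a _.
by exists m => //; exact: ltW.
Qed.

Lemma exp2z_neq0 (i : int) : 2 ^ i != 0 :> R.
Proof. by rewrite expfz_neq0 // pnatr_eq0. Qed.

Lemma exp2z_gt0 (i : int) : 0 < 2 ^ i :> R.
Proof. by rewrite exprz_gt0. Qed.

Lemma exp2z_inj (i j : int) : 2 ^ i = 2 ^ j :> R -> i = j.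
Proof.
have mono := ler_eXz2l (ltr1n R 2).
by move=> e; apply/eqP; rewrite eq_le -!mono e lexx.
Qed.

End Log2.

(** * Vectors whose nonzero entries are powers of 2, and their levels *)

Section Levels.
Variables (R : realType) (V : finType).
Implicit Types (x y z : V -> R).

Definition dyadic x := forall u, x u = 0 \/ exists i : int, x u = 2 ^ i.

(* Pruning with parameter 1 / kappa ensures this. *)
Definition spread (kappa : R) x := forall u, x u != 0 -> norm x < kappa * x u.

Lemma dyadic_ge0 x : dyadic x -> forall u, 0 <= x u.
Proof. by move=> xd u; case: (xd u) => [->|[i ->]] //; exact/ltW/exp2z_gt0. Qed.

Lemma dyadic_round z : dyadic (round z).
Proof.
move=> u; rewrite /round; case: eqP => _; first by left.
by right; exists (round_exp (z u)).
Qed.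

Lemma dyadic_prune eps z : dyadic z -> dyadic (prune eps z).
Proof. by move=> zd u; rewrite /prune; case: ifP => _; [left | exact: zd]. Qed.

(** If the rounded value exceeded twice the entry, half of it would be a smaller power of 2 still
    above the entry. *)
Lemma round_bounds z u : 0 <= z u -> z u <= round z u <= 2 * z u.
Proof.
rewrite /round le_eqVlt => /predU1P[<-|z0].
  by rewrite eqxx mulr0 lexx.
rewrite gt_eqF //; have [-> rmin] := round_expP z0 => /=.
rewrite leNgt; apply/negP => lt_z.
have /rmin : z u <= 2 ^ (round_exp (z u) - 1).
  rewrite -(ler_pM2l (ltr0n _ 2)) (le_trans (ltW lt_z)) //.
  rewrite -{1}(subrK 1 (round_exp (z u))) expfzDr ?pnatr_eq0 //.
  by rewrite expr1z mulrC.
by rewrite lerBrDr gerDl.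
Qed.

Lemma round_ge0 z : (forall u, 0 <= z u) -> forall u, 0 <= round z u.
Proof. by move=> z0 u; apply: le_trans (z0 u) _; case/andP: (round_bounds (z0 u)). Qed.

Lemma prune_le eps z u : 0 <= z u -> 0 <= prune eps z u <= z u.
Proof. by move=> z0; rewrite /prune; case: ifP => _; rewrite ?lexx z0. Qed.

Lemma prune_neq0 eps z u : prune eps z u != 0 ->
  prune eps z u = z u /\ eps * norm z < z u.
Proof.
rewrite /prune; case: ifP => [_|/negbT]; first by rewrite eqxx.
by rewrite -ltNge.
Qed.

Lemma inner_prune_le eps z : (forall u, 0 <= z u) ->
  inner (prune eps z) (prune eps z) <= inner z z.
Proof.
move=> z0; apply: ler_sum => u _; have /andP[p0 pz] := prune_le eps (z0 u).
exact: ler_pM.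
Qed.

(** Surviving entries exceed [eps] times the norm before pruning, which dominates the norm after
    pruning. *)
Lemma spread_prune eps kappa z : 0 <= kappa -> 1 <= kappa * eps ->
  (forall u, 0 <= z u) -> spread kappa (prune eps z).
Proof.
move=> k0 ke z0 u /prune_neq0[-> ltz].
have k1 : 0 < kappa.
  by rewrite lt_neqAle k0 andbT; apply: contraTneq ke => <-; rewrite mul0r ler10.
apply: le_lt_trans (ler_norm_inner (inner_prune_le eps z0)) _.
apply: (@le_lt_trans _ _ (kappa * (eps * norm z))); last by rewrite ltr_pM2l.
by rewrite mulrA ler_peMl ?norm_ge0.
Qed.

(** Entries of one level are equal, so the threshold keeps all or none of them. Hence pruning
    [round (mulA G x)] in the analysis creates no new nonempty level set beyond those the algorithm
    examines. *)
Lemma level_set_prune eps z i : level_set (prune eps z) i != set0 ->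
  level_set (prune eps z) i = level_set z i.
Proof.
case/set0Pn => w; rewrite inE => /eqP pw.
have /prune_neq0[zw] : prune eps z w != 0 by rewrite pw exp2z_neq0.
rewrite -zw pw => ltz; apply/setP => u; rewrite !inE /prune.
case: ifP => // le_z; rewrite eq_sym (negbTE (exp2z_neq0 _ _)).
by apply/esym/negbTE; apply: contraTneq le_z => ->; rewrite -ltNge.
Qed.

(** With [2 ^ i0] the smallest nonzero entry, every exponent [k] that occurs satisfies
    [2 ^ (k - i0) < kappa <= 2 ^ m]. Empty levels in between contribute nothing. *)
Lemma dyadic_levels x kappa : 1 <= kappa -> dyadic x -> spread kappa x ->
  exists (m : nat) (i0 : int), m%:R <= log2 kappa + 1 /\
    forall u, x u = \sum_(i < m) 2 ^ (i0 + i%:Z) * indic R (level_set x (i0 + i%:Z)) u.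
Proof.
move=> k1 xd xs; have [x0|] := boolP [forall u, x u == 0].
  exists 0%N, 0; split; first by rewrite addr_ge0 ?log2_ge0.
  by move=> u; rewrite big_ord0; exact/eqP/(forallP x0).
rewrite negb_forall => /existsP[w0 xw0].
have [u0 xu0 xmin] := @arg_minP _ _ _ w0 (fun u => x u != 0) x xw0.
case: (xd u0) => [/eqP|[i0 xu0E]]; first by rewrite (negbTE xu0).
have [m km lem] := exists_exp2_bound k1.
exists m, i0; split => // u.
have idE (i : 'I_m) : indic R (level_set x (i0 + i%:Z)) u = (x u == 2 ^ (i0 + i%:Z))%:R.
  by rewrite /indic inE.
under eq_bigr do rewrite idE.
case: (xd u) => [->|[k xuE]].
  rewrite big1 // => i _.
  by rewrite eq_sym (negbTE (exp2z_neq0 _ _)) mulr0.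
have xuN0 : x u != 0 by rewrite xuE exp2z_neq0.
have : i0 <= k.
  by have := xmin u xuN0; rewrite xuE xu0E ler_eXz2l // ltr1n.
rewrite -subr_ge0; case E : (k - i0) => [n|//] _.
have kE : k = i0 + n%:Z by rewrite -E addrC subrK.
have nm : (n < m)%N.
  have := le_lt_trans (ler_entry_norm x u) (xs _ xu0).
  rewrite xuE xu0E kE expfzDr ?pnatr_eq0 // mulrC ltr_pM2r ?exp2z_gt0 // => /lt_le_trans.
  by move=> /(_ _ km); rewrite -exprnP ltr_eXn2l // ltr1n.
rewrite (bigD1 (Ordinal nm)) //= xuE kE eqxx mulr1 big1 ?addr0 // => i iN.
case: eqP => [/exp2z_inj/addrI[ni]|]; last by rewrite mulr0.
by case/eqP: iN; apply: val_inj.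
Qed.

(** Cauchy-Schwarz against the all-ones vector of length [m]; the squared terms are the
    contributions of the levels to [inner x x]. *)
Lemma sum_levels_le x m i0 :
  (forall u, x u = \sum_(i < m) 2 ^ (i0 + i%:Z) * indic R (level_set x (i0 + i%:Z)) u) ->
  (\sum_(i < m) 2 ^ (i0 + i%:Z) * Num.sqrt #|level_set x (i0 + i%:Z)|%:R) ^+ 2
    <= m%:R * inner x x.
Proof.
move=> xE; pose a (i : 'I_m) : R := 2 ^ (i0 + i%:Z) * Num.sqrt #|level_set x (i0 + i%:Z)|%:R.
have := cauchy_schwarz a (fun=> 1).
have -> : inner a (fun=> 1) = \sum_i a i by apply: eq_bigr => i _; rewrite mulr1.
have -> : inner (fun=> 1) (fun _ : 'I_m => 1 : R) = m%:R.
  by rewrite /inner sumr_const card_ord mulr1.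
suff -> : inner a a = inner x x by rewrite mulrC.
rewrite {2}/inner; under [RHS]eq_bigr do rewrite {2}xE mulr_sumr.
rewrite exchange_big; apply: eq_bigr => i _ /=.
rewrite /a mulrACA -[X in _ * X]expr2 sqr_sqrtr ?ler0n // -inner_indic inner_indicr.
rewrite mulr_sumr big_mkcond; apply: eq_bigr => u _; rewrite /indic inE.
by case: eqP => [->|_]; rewrite ?mulr1 ?mulr0.
Qed.

End Levels.

(** * Upper bound on the growth of the norm in one step *)

Section GrowthStep.
Variables (R : realType) (V : finType) (G : bipartite_graph R V).
Implicit Types (x y z : V -> R) (S T : {set V}).

Lemma inner_mulA_sum m n (c : 'I_m -> R) (d : 'I_n -> R)
    (X : 'I_m -> {set V}) (Y : 'I_n -> {set V}) x y :
  (forall u, x u = \sum_i c i * indic R (X i) u) ->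
  (forall u, y u = \sum_j d j * indic R (Y j) u) ->
  inner (mulA G x) y = \sum_i \sum_j c i * d j * edge_weight G (X i) (Y j).
Proof.
move=> xE yE.
have -> : inner (mulA G x) y = \sum_i c i * inner (mulA G (indic R (X i))) y.
  under [RHS]eq_bigr do rewrite inner_mulA_sym.
  rewrite inner_mulA_sym {1}/inner; under [LHS]eq_bigr do rewrite xE mulr_suml.
  rewrite exchange_big; apply: eq_bigr => i _ /=.
  by rewrite /inner mulr_sumr; apply: eq_bigr => u _; rewrite mulrA.
apply: eq_bigr => i _; rewrite /inner.
under eq_bigr do rewrite yE mulr_sumr.
rewrite exchange_big mulr_sumr; apply: eq_bigr => j _ /=.
rewrite /edge_weight /inner !mulr_sumr; apply: eq_bigr => u _.
by rewrite -mulrA; congr (_ * _); rewrite mulrCA.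
Qed.

Lemma edge_weight_density S T : S != set0 -> T != set0 ->
  edge_weight G S T = density G S T * (Num.sqrt #|S|%:R * Num.sqrt #|T|%:R).
Proof.
move=> S0 T0; rewrite mulfVK // mulf_neq0 // sqrtr_eq0 -ltNge ltr0n card_gt0 //.
Qed.

Lemma edge_weight_le_density (D : R) S T : 0 <= D ->
  (S != set0 -> T != set0 -> density G S T <= D) ->
  edge_weight G S T <= D * (Num.sqrt #|S|%:R * Num.sqrt #|T|%:R).
Proof.
move=> D0 SD; have DST : 0 <= D * (Num.sqrt #|S|%:R * Num.sqrt #|T|%:R).
  by rewrite !mulr_ge0 ?sqrtr_ge0.
have [S0|S0] := eqVneq S set0; first by rewrite edge_weightE {1}S0 big_set0.
have [T0|T0] := eqVneq T set0.
  by rewrite edge_weightE {1}T0 big1 // => u _; rewrite big_set0.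
by rewrite edge_weight_density // ler_wpM2r ?SD // mulr_ge0 ?sqrtr_ge0.
Qed.

(** After expansion over pairs of levels, bounding each edge weight by [D] factors the double sum as
    [D * (a * b)], and each factor is at most [Num.sqrt L] times a norm. *)
Lemma inner_mulA_le_levels (D L kx ky : R) x y : 0 <= D ->
    dyadic x -> dyadic y -> 1 <= kx -> 1 <= ky -> spread kx x -> spread ky y ->
    log2 kx + 1 <= L -> log2 ky + 1 <= L ->
    (forall i j, level_set x i != set0 -> level_set y j != set0 ->
       density G (level_set x i) (level_set y j) <= D) ->
  inner (mulA G x) y <= D * L * (norm x * norm y).
Proof.
move=> D0 xd yd kx1 ky1 xs ys kxL kyL xyD.
have [m [i0 [mL xE]]] := dyadic_levels kx1 xd xs.
have [n [j0 [nL yE]]] := dyadic_levels ky1 yd ys.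
have L0 : 0 <= L by apply: le_trans kxL; rewrite addr_ge0 ?log2_ge0.
pose a := \sum_(i < m) 2 ^ (i0 + i%:Z) * Num.sqrt #|level_set x (i0 + i%:Z)|%:R : R.
pose b := \sum_(j < n) 2 ^ (j0 + j%:Z) * Num.sqrt #|level_set y (j0 + j%:Z)|%:R : R.
have sum_le z k (kL : k%:R <= L) c : 0 <= c -> c ^+ 2 <= k%:R * inner z z ->
    c <= Num.sqrt L * norm z.
  move=> c0 cz; rewrite -(ler_pXn2r (n := 2)) ?nnegrE ?mulr_ge0 ?sqrtr_ge0 //.
  rewrite exprMn sqr_sqrtr // sqr_norm.
  by apply: le_trans cz _; rewrite ler_wpM2r ?inner_self_ge0.
have a0 : 0 <= a by apply: sumr_ge0 => i _; rewrite mulr_ge0 ?sqrtr_ge0 ?ltW ?exp2z_gt0.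
have b0 : 0 <= b by apply: sumr_ge0 => i _; rewrite mulr_ge0 ?sqrtr_ge0 ?ltW ?exp2z_gt0.
have aL := sum_le x m (le_trans mL kxL) a a0 (sum_levels_le xE).
have bL := sum_le y n (le_trans nL kyL) b b0 (sum_levels_le yE).
apply: (@le_trans _ _ (D * (a * b))); last first.
  rewrite -mulrA ler_wpM2l //; apply: le_trans (ler_pM a0 b0 aL bL) _.
  by rewrite mulrACA -expr2 sqr_sqrtr.
rewrite (inner_mulA_sum xE yE) [a * b]mulr_suml mulr_sumr; apply: ler_sum => i _.
rewrite [_ * _ * b]mulr_sumr [leRHS]mulr_sumr; apply: ler_sum => j _.
rewrite [_ * Num.sqrt _ * _]mulrACA [leRHS]mulrCA ler_wpM2l //.
  by rewrite mulr_ge0 ?ltW ?exp2z_gt0.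
by apply: edge_weight_le_density => //; exact: xyD.
Qed.

Definition supp x : {set V} := [set u | x u != 0].

(** Each nonzero entry contributes at least [(norm x / kappa) ^+ 2] to [inner x x]. *)
Lemma card_supp_spread kappa x : 0 <= kappa -> spread kappa x ->
  #|supp x|%:R <= kappa ^+ 2.
Proof.
move=> k0 xs; have [n0|nN0] := eqVneq (inner x x) 0.
  rewrite [supp x](_ : _ = set0) ?cards0 ?sqr_ge0 //.
  by apply/setP => u; rewrite !inE (inner_self_eq0 n0) eqxx.
have np : 0 < inner x x by rewrite lt_neqAle eq_sym nN0 inner_self_ge0.
rewrite -(ler_pM2r np) [leRHS]mulr_sumr -sum1_card natr_sum [leLHS]mulr_suml.
rewrite [leLHS]big_mkcond; apply: ler_sum => u _; rewrite inE.
case: ifPn => [xu|/negPn/eqP->]; last by rewrite !mulr0.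
rewrite mul1r -sqr_norm -[_ * x u]expr2 -exprMn lerXn2r ?nnegrE ?norm_ge0 //.
  exact: le_trans (norm_ge0 x) (ltW (xs _ xu)).
exact/ltW/xs.
Qed.

Lemma card_supp_mulA x :
  (#|supp (mulA G x)| <= max_degree G * #|supp x|)%N.
Proof.
apply: (@leq_trans #|\bigcup_(u in supp x) [set w | adj G u w]|).
  apply/subset_leq_card/subsetP => w; rewrite inE.
  apply: contraNT => /bigcupP wN; rewrite /mulA big1 // => u _.
  have [->|xu] := eqVneq (x u) 0; first by rewrite mul0r.
  rewrite weight_nonadj ?mulr0 //; apply/negP => uw.
  by apply: wN; exists u; rewrite inE.
rewrite mulnC -sum_nat_const.
apply: (@leq_trans (\sum_(u in supp x) #|[set w | adj G u w]|)); last first.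
  apply: leq_sum => u _.
  exact: (@leq_bigmax _ (fun u => #|[set w | adj G u w]|)).
elim/big_rec2: _ => [|u n A _ An]; first by rewrite cards0.
by rewrite (leq_trans (leq_card_setU _ _)) // leq_add2l.
Qed.

(** The last term pays for the removed entries: at most [n] of them are nonzero, each at most
    [delta * norm z]. *)
Lemma inner_self_prune_ge z (delta n : R) : (forall u, 0 <= z u) ->
    0 <= delta -> #|supp z|%:R <= n ->
  inner z z <= inner (prune delta z) (prune delta z) + delta ^+ 2 * n * inner z z.
Proof.
move=> z0 d0 zn.
apply: (@le_trans _ _ (inner (prune delta z) (prune delta z)
                       + delta ^+ 2 * #|supp z|%:R * inner z z)); last first.
  by rewrite lerD2l ler_wpM2r ?inner_self_ge0 // ler_wpM2l ?sqr_ge0.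
rewrite mulrAC -sqr_norm -exprMn -sum1_card natr_sum mulr_sumr sqr_norm.
rewrite [X in _ + X]big_mkcond /inner -big_split; apply: ler_sum => u _ /=.
rewrite inE mulr1 /prune; case: ifP => [zu|_]; last first.
  by rewrite lerDl; case: ifP; rewrite ?sqr_ge0.
rewrite mul0r add0r; case: eqP => [->|_ /=]; first by rewrite mulr0.
by rewrite -expr2 lerXn2r ?nnegrE ?mulr_ge0 ?norm_ge0.
Qed.

(** The vector [z] may have too many levels, so the analysis prunes it to [y]. Then
    [|y|^2 <= 2 <x A, y> <= 2 D L |x| |y|], and [y] keeps most of the norm of [z]. *)
Lemma growth_step (D kappa : R) x : 0 <= D -> 4 <= kappa ->
    (0 < max_degree G)%N -> dyadic x -> spread kappa x ->
    (forall i j, level_set x i != set0 ->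
       level_set (round (mulA G x)) j != set0 ->
       density G (level_set x i) (level_set (round (mulA G x)) j) <= D) ->
  norm (round (mulA G x))
    <= 8 / 3 * D * log2 (4 * (max_degree G)%:R * kappa) * norm x.
Proof.
set Delta := (max_degree G)%:R; set L := log2 _ => D0 k4 Delta0 xd xs xD.
have Delta1 : 1 <= Delta by rewrite /Delta ler1n.
have k0 : 0 < kappa by lra.
set z := round (mulA G x).
have x0 := dyadic_ge0 xd; have w0 := mulA_ge0 G x0; have z0 := round_ge0 w0.
(* As [z] has at most [Delta kappa^2] nonzero entries, the lost share of its squared norm is at most
   [Delta kappa^2 / ky^2 = 1 / (4 Delta)], hence at most a quarter. *)
pose ky := 2 * Delta * kappa; pose y := prune ky^-1 z.
have ky2 : 2 <= ky by rewrite /ky; nra.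
have kyp : 0 < ky by lra.
have y0 u : 0 <= y u by case/andP: (prune_le ky^-1 (z0 u)).
have yd : dyadic y by apply/dyadic_prune/dyadic_round.
have ys : spread ky y by apply: spread_prune; rewrite ?divff // ?gt_eqF // ltW.
(* The factor 4 inside [L] makes its argument [2 ky], so that [L] is exactly the level count allowed
   by [dyadic_levels]. *)
have LE : L = log2 ky + 1.
  rewrite -[1](log2_2X R 1) -log2M // ?exprn_gt0 // expr1 /ky /L; congr log2; ring.
have kL : log2 kappa + 1 <= L by rewrite LE lerD2r ler_log2 // /ky; nra.
have L0 : 0 <= L by rewrite LE addr_ge0 // log2_ge0 //; lra.
clearbody L.
have zy : inner z z <= (4 / 3) * inner y y.
  have suppz : #|supp z|%:R <= Delta * kappa ^+ 2.
    apply: (@le_trans _ _ (max_degree G * #|supp x|)%:R).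
      rewrite ler_nat; apply: leq_trans (card_supp_mulA x).
      apply/subset_leq_card/subsetP => u; rewrite !inE.
      by apply: contraNN => /eqP wu; rewrite /z /round wu eqxx.
    by rewrite natrM ler_wpM2l ?ler0n // card_supp_spread // ltW.
  have ky0 : 0 <= ky^-1 by rewrite invr_ge0 ltW.
  have := inner_self_prune_ge z0 ky0 suppz.
  have -> : inner (prune ky^-1 z) (prune ky^-1 z) = inner y y by [].
  suff : ky^-1 ^+ 2 * (Delta * kappa ^+ 2) <= 1 / 4.
    move=> h; have := ler_wpM2r (inner_self_ge0 z) h; lra.
  have -> : ky^-1 ^+ 2 * (Delta * kappa ^+ 2) = (4 * Delta)^-1.
    rewrite /ky; field; lra.
  by rewrite div1r lef_pV2 ?posrE; lra.
have yw : inner y y <= 2 * inner (mulA G x) y.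
  rewrite /inner mulr_sumr; apply: ler_sum => u _; rewrite mulrA ler_wpM2r //.
  case/andP: (prune_le ky^-1 (z0 u)) => _ /le_trans; apply.
  by case/andP: (round_bounds (w0 u)).
have yx : norm y <= 2 * (D * L) * norm x.
  have [->|yN0] := eqVneq (norm y) 0.
    by rewrite -mulrA mulr_ge0 // mulr_ge0 ?norm_ge0 // mulr_ge0.
  have yp : 0 < norm y by rewrite lt_neqAle eq_sym yN0 norm_ge0.
  rewrite -(ler_pM2r yp) -expr2 sqr_norm (le_trans yw) //.
  have -> : 2 * (D * L) * norm x * norm y = 2 * (D * L * (norm x * norm y)).
    by ring.
  rewrite ler_pM2l //.
  apply: (inner_mulA_le_levels D0 xd yd _ _ xs ys kL); rewrite ?LE //; try lra.
  move=> i j X0 Y0; have YE := level_set_prune Y0; rewrite -/y in YE.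
  by rewrite YE; apply: xD; rewrite -?YE.
have DLx := mulr_ge0 (mulr_ge0 D0 L0) (norm_ge0 x).
(* After squaring, the constants compare as [4/3 * 2^2 <= (8/3)^2]. *)
rewrite -(ler_pXn2r (n := 2)) ?nnegrE ?norm_ge0 //; last by lra.
rewrite sqr_norm (le_trans zy) // -sqr_norm.
have : norm y ^+ 2 <= (2 * (D * L) * norm x) ^+ 2.
  by rewrite lerXn2r ?nnegrE ?norm_ge0 //; lra.
move: DLx; set q := D * L * norm x => q0.
have -> : 8 / 3 * D * L * norm x = 8 / 3 * q by rewrite /q; ring.
have -> : 2 * (D * L) * norm x = 2 * q by rewrite /q; ring.
nra.
Qed.

End GrowthStep.

(** * The two growth bounds against each other, and the output of the algorithm *)

Section DenseCandidate.
Variables (R : realType) (V : finType) (G : bipartite_graph R V).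

(** Witnesses are built for the sizes of the target subgraph, whereas the algorithm runs with any
    larger [K]. *)
Lemma le_growth_witness (theta K0 K : R) (v : V) f : K0 <= K ->
  growth_witness G theta K0 v f -> growth_witness G theta K v f.
Proof.
move=> K0K [f0 f1 fs fv fA]; split => // [t|]; first exact: le_trans K0K.
by apply: le_trans fv _; rewrite ler_wpM2r ?sqr_ge0.
Qed.

Lemma inner_prune_ge (eps : R) (z f : V -> R) : 0 <= eps ->
  (forall u, 0 <= f u) ->
  inner z f - eps * norm z * \sum_u f u <= inner (prune eps z) f.
Proof.
move=> e0 f0; rewrite mulr_sumr -sumrB; apply: ler_sum => u _.
rewrite -mulrBl ler_wpM2r // /prune; case: ifP => [zu|_].
  by rewrite subr_le0.
by rewrite gerBl mulr_ge0 ?norm_ge0.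
Qed.

(** * The process of the algorithm under an assumption of slow growth *)

Section Process.
Variables (v : V) (K : R).
Hypothesis K1 : 1 <= K.
Let x t := ld_x G v K t.
Let z t := round (mulA G (x t)).

Lemma ld_eps_ge0 t : 0 <= ld_eps K t.
Proof. by rewrite divr_ge0 ?exprn_ge0 ?mulr_ge0 // (le_trans ler01). Qed.

Lemma dyadic_ld_x t : dyadic (x t).
Proof.
case: t => [|t]; last exact/dyadic_prune/dyadic_round.
move=> u; rewrite /x /ld_x /= /indic; case: (u \in _); last by left.
by right; exists 0; rewrite expr0z.
Qed.

Lemma norm_ld_x0 : norm (x 0%N) = 1.
Proof. by rewrite /norm [inner _ _]inner_indic cards1 sqrtr1. Qed.

Lemma ld_xS t : x t.+1 = prune (ld_eps K t.+1) (z t).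
Proof. by []. Qed.

Lemma round_mulA_ld_bounds t u : mulA G (x t) u <= z t u <= 2 * mulA G (x t) u.
Proof. exact/round_bounds/mulA_ge0/dyadic_ge0/dyadic_ld_x. Qed.

Lemma round_mulA_ld_ge0 t u : 0 <= z t u.
Proof. exact/round_ge0/mulA_ge0/dyadic_ge0/dyadic_ld_x. Qed.

(** The smallest threshold used is that of time 1, namely [1 / (4 K)]. *)
Lemma spread_ld_x t : spread (4 * K) (x t).
Proof.
have k1 := K1.
case: t => [|t].
  move=> u; rewrite norm_ld_x0 /x /ld_x /= /indic.
  by case: (u \in _); rewrite /= ?eqxx // => _; rewrite mulr1; lra.
rewrite ld_xS; apply: spread_prune; [lra| |exact: round_mulA_ld_ge0].
have -> : 4 * K * ld_eps K t.+1 = 2 ^+ t.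
  by rewrite /ld_eps exprS; field; lra.
by rewrite exprn_ege1 // ler1n.
Qed.

Variables (theta : R) (f : nat -> V -> R) (n : nat).
Hypotheses (theta0 : 0 < theta) (wit : growth_witness G theta K v f).
Hypothesis slow : forall t, (t < n)%N -> norm (z t) <= theta / 3 * norm (x t).

(** The correlation with [f t] gains a factor [theta] per step, less the pruning loss. The loss is
    controlled by the norm bound, which is why both claims are proved in one induction. *)
Lemma slow_growth t : (t <= n)%N -> norm (x t) <= (theta / 3) ^+ t /\
  theta ^+ t * (3 / 4 + 1 / 4 * (2 / 3) ^+ t)
    <= Num.sqrt K * inner (x t) (f t).
Proof.
have [f0 f1 fs fv fA] := wit; have k1 := K1; have th0 := theta0.
set s := Num.sqrt K; have sK : s ^+ 2 = K by rewrite sqr_sqrtr // (le_trans ler01).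
have s0 : 0 <= s by apply: sqrtr_ge0.
clearbody s.
elim: t => [_|t IH tn].
  rewrite norm_ld_x0 !expr0; split => //.
  rewrite innerC [inner _ _]inner_indicr big_set1.
  have : 1 <= s * f 0%N v; last by lra.
  by rewrite -(ler_pXn2r (n := 2)) ?nnegrE ?mulr_ge0 // exprMn sK expr1n.
have [xt pt] := IH (ltnW tn); have zt := slow tn.
have zt' : norm (z t) <= (theta / 3) ^+ t.+1.
  rewrite exprS; apply: le_trans zt _; rewrite ler_pM2l //; lra.
split.
  apply: le_trans zt'; rewrite ld_xS; apply: ler_norm_inner.
  exact/inner_prune_le/round_mulA_ld_ge0.
have sumf0 : 0 <= \sum_u f t.+1 u by apply: sumr_ge0.
have sumf : \sum_u f t.+1 u <= s.
  by rewrite -(ler_pXn2r (n := 2)) ?nnegrE // sK.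
have pS := inner_prune_ge (z t) (ld_eps_ge0 t.+1) (f0 t.+1).
rewrite -ld_xS in pS.
(* Symmetry moves the matrix onto [f], and rounding up only increases the correlation. *)
have zf : theta * inner (x t) (f t) <= inner (z t) (f t.+1).
  apply: (@le_trans _ _ (inner (mulA G (x t)) (f t.+1))).
    rewrite inner_mulA_sym -innerZr; apply: ler_inner => //.
    exact/dyadic_ge0/dyadic_ld_x.
  rewrite innerC [leRHS]innerC; apply: ler_inner => // u.
  by case/andP: (round_mulA_ld_bounds t u).
have eK : 2 ^+ t.+1 / 8 = s * ld_eps K t.+1 * s.
  by rewrite mulrAC -expr2 sK /ld_eps; field; lra.
have loss : s * (ld_eps K t.+1 * norm (z t) * \sum_u f t.+1 u)
    <= 2 ^+ t.+1 / 8 * (theta / 3) ^+ t.+1.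
  have se0 := mulr_ge0 s0 (ld_eps_ge0 t.+1).
  have := ler_wpM2l se0 (ler_pM sumf0 (norm_ge0 _) sumf zt').
  by rewrite eK !mulrA; congr (_ <= _); ring.
(* Up to [theta ^+ t.+1], this loss is [(2/3)^t / 12], exactly the decrease of [1/4 (2/3)^t] from
   [t] to [t.+1]. *)
have E1 : 2 ^+ t.+1 / 8 * (theta / 3) ^+ t.+1
    = theta * theta ^+ t * ((2 / 3) ^+ t / 12).
  by rewrite !exprS !exprMn; field.
rewrite E1 in loss.
have h1 := ler_wpM2l s0 pS; have h2 := ler_wpM2l s0 zf.
have h3 := ler_wpM2l (ltW theta0) pt.
rewrite !exprS; move: h1 h2 h3 loss.
move: (theta ^+ t) ((2 / 3) ^+ t) (inner (x t) _) (inner (z t) _).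
move: (inner (x t.+1) _) (ld_eps _ _ * _ * _) => p' e a b p q; lra.
Qed.

(** Correlation is at most the norm, so [3/4 theta^n <= sqrt K (theta/3)^n], that is
    [3/4 3^n <= sqrt K]. For positive [n], [3^n >= 3/2 2^n]. The conclusion fails at [n = tau]. *)
Lemma slow_growth_short : (0 < n)%N -> (2 ^+ n) ^+ 2 < 2 * K.
Proof.
move=> n0; have [xn pn] := slow_growth (leqnn n).
have [_ f1 _ _ _] := wit; have k1 := K1; have th0 := theta0.
move: pn; set s := Num.sqrt K => pn.
have sK : s ^+ 2 = K by rewrite sqr_sqrtr // (le_trans ler01).
have s0 : 0 <= s by apply: sqrtr_ge0.
clearbody s.
have p_le : inner (x n) (f n) <= (theta / 3) ^+ n.
  apply: le_trans (inner_le_norm _ _) _; apply: le_trans xn.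
  by rewrite ler_piMr ?norm_ge0 // -(sqrtr1 R) ler_wsqrtr.
have tn0 : 0 < theta ^+ n by rewrite exprn_gt0.
have t3 : 0 < 3 ^+ n :> R by rewrite exprn_gt0.
have s3 : 3 / 4 * 3 ^+ n <= s.
  rewrite -(ler_pM2l tn0).
  have := le_trans pn (ler_wpM2l s0 p_le); rewrite [(theta / 3) ^+ n]exprMn exprVn => h.
  have b0 : 0 <= (2 / 3) ^+ n :> R by rewrite exprn_ge0 // divr_ge0.
  have : theta ^+ n * (3 / 4) <= s * (theta ^+ n / 3 ^+ n).
    by apply: le_trans h; rewrite ler_pM2l //; lra.
  by rewrite [s * _]mulrA ler_pdivlMr // [s * _]mulrC -[_ * (3 / 4) * _]mulrA.
have n32 : 3 / 2 * 2 ^+ n <= 3 ^+ n :> R.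
  move: n0; case: (n) => // k _; rewrite !exprS.
  have : 2 ^+ k <= 3 ^+ k :> R by rewrite lerXn2r ?nnegrE ?ler_nat.
  lra.
have n2 : 0 < 2 ^+ n :> R by rewrite exprn_gt0.
rewrite -sK; have : 9 / 8 * 2 ^+ n <= s by lra.
by move: (2 ^+ n) n2 => a a0 as'; nra.
Qed.

End Process.

(** If all candidates had density below [D], then [growth_step] with [kappa = 4 K] would give the
    slow growth rate [8/3 D L = theta / 3] up to time [tau]. *)
Lemma exists_dense_candidate (v : V) (K theta : R) f :
    0 < theta -> 1 <= K -> (0 < max_degree G)%N ->
    growth_witness G theta K v f ->
  exists X Y, ld_candidate G v K X Y /\
    theta / (8 * log2 (16 * (max_degree G)%:R * K)) <= density G X Y.
Proof.
move=> theta0 K1 Delta0 wit; apply: contrapT => noXY.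
have Delta1 : 1 <= (max_degree G)%:R :> R by rewrite ler1n.
have DK1 := mulr_ege1 Delta1 K1.
have LE : 16 * (max_degree G)%:R * K = 4 * (max_degree G)%:R * (4 * K) by ring.
have L0 : 0 < log2 (4 * (max_degree G)%:R * (4 * K)).
  apply: (@lt_le_trans _ _ 1) => //.
  by rewrite -[leLHS](log2_2X R 1) ler_log2 ?exprn_gt0 // expr1 -LE -mulrA; lra.
pose D := theta / (8 * log2 (4 * (max_degree G)%:R * (4 * K))).
have D0 : 0 <= D by apply: divr_ge0; lra.
have DL : 8 / 3 * D * log2 (4 * (max_degree G)%:R * (4 * K)) = theta / 3.
  by rewrite /D; move: (log2 _) L0 => L L0; field; lra.
have k4 : 4 <= 4 * K by lra.
have K2 : 0 <= 2 * K by lra.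
have candD X Y : ld_candidate G v K X Y -> density G X Y <= D.
  move=> XY; rewrite leNgt; apply/negP => /ltW DXY.
  by apply: noXY; exists X, Y; split; rewrite ?LE.
(* The strict bound makes [tau] positive; the other one contradicts [slow_growth_short]. *)
have /andP[s1 tau_ge] : 1 < Num.sqrt (2 * K) <= 2 ^ ld_tau K.
  have s1 : 1 < Num.sqrt (2 * K) by rewrite -{1}(sqrtr1 R) ltr_sqrt; lra.
  by rewrite s1; apply: (round_expP _).1; lra.
have [n tau_n n0] : exists2 n : nat, ld_tau K = n%:Z & (0 < n)%N.
  move: (lt_le_trans s1 tau_ge); rewrite -{1}(expr0z (2 : R)).
  by rewrite ltr_eXz2l ?ltr1n //; case: (ld_tau K) => // n n0; exists n.
have slow t : (t < n)%N ->
    norm (round (mulA G (ld_x G v K t))) <= theta / 3 * norm (ld_x G v K t).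
  move=> tn.
  have := growth_step D0 k4 Delta0 (dyadic_ld_x v K t) (@spread_ld_x v K K1 t).
  have step i j : ld_X G v K t i != set0 -> ld_Y G v K t j != set0 ->
      density G (ld_X G v K t i) (ld_Y G v K t j) <= D.
    by move=> Xi Yj; apply: candD; exists t, i, j; rewrite tau_n ltz_nat.
  move=> /(_ step) {step candD} le_z; apply: le_trans le_z _.
  by rewrite DL.
have := slow_growth_short K1 theta0 wit slow n0; rewrite ltNge => /negP; apply.
by rewrite -(sqr_sqrtr K2) lerXn2r ?nnegrE ?sqrtr_ge0 ?exprn_ge0 // [_ ^+ n]exprnP -tau_n.
Qed.

(** Candidates are indexed by arbitrary integers, but there are finitely many pairs of vertex sets,
    so a maximum is attained. *)
Lemma exists_local_density_output (v : V) (K : R) X Y :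
  ld_candidate G v K X Y ->
  exists X' Y', local_density_output G v K X' Y'.
Proof.
move=> XY; pose P (p : {set V} * {set V}) := `[< ld_candidate G v K p.1 p.2 >].
have PXY : P (X, Y) by apply/asboolP.
have [[X' Y'] /asboolP X'Y' maxP] :=
  arg_maxP (fun p => density G p.1 p.2) PXY.
exists X', Y'; split => // X0 Y0 X0Y0.
by apply: (maxP (X0, Y0)); exact/asboolP.
Qed.

Lemma max_degree_gt0 (S T : {set V}) : edge_weight G S T != 0 ->
  (0 < max_degree G)%N.
Proof.
rewrite lt0n; apply: contraNN => /eqP D0; rewrite edge_weightE.
apply/eqP/big1 => u _; apply: big1 => w _; apply: weight_nonadj.
apply/negP => uw; have := @leq_bigmax _ (fun u => #|[set w | adj G u w]|) u.
rewrite -/(max_degree G) D0 leqn0 cards_eq0 => /eqP/setP/(_ w).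
by rewrite !inE uw.
Qed.

Lemma edge_weightID (S T B : {set V}) : B \subset S ->
  edge_weight G S T = edge_weight G B T + edge_weight G (S :\: B) T.
Proof.
move=> BS; rewrite !edge_weightE (big_setID B) /=; congr (_ + _).
by rewrite (setIidPr BS).
Qed.

End DenseCandidate.

(** * Choice of the starting vertices and the logarithmic bound *)

Theorem theorem1 (R : realType) :
  exists2 c : R, 0 < c &
  forall (V : finType) (G : bipartite_graph R V) (S T : {set V}) (theta : R),
    S \subset left G -> T \subset right G ->
    2 * theta <= density G S T ->
  exists Stheta : {set V},
    [/\ Stheta \subset S,
        edge_weight G S T / 2 <= edge_weight G Stheta T
      & forall (v : V) (K : R),
          v \in Stheta -> (maxn #|S| #|T|)%:R <= K ->
        let bound := theta / (8 * log2 (16 * (max_degree G)%:R * K)) in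
        [/\ exists X Y : {set V}, local_density_output G v K X Y,
            forall X Y : {set V},
              local_density_output G v K X Y -> bound <= density G X Y
          & 0 <= theta -> K <= #|V|%:R ->
            c * (theta / log2 #|V|%:R) <= bound]].
Proof.
(* The constant is [1 / (8 * 6)], where 6 comes from [L <= 6 * log2 n] below. *)
exists (1 / 48); first by lra.
move=> V G S T theta SL TR dST.
have [e0|eN0] := eqVneq (edge_weight G S T) 0.
  exists set0; split; first exact: sub0set; last by move=> v K; rewrite inE.
  by rewrite e0 mul0r edge_weight_ge0.
have Delta0 := max_degree_gt0 eN0.
have S0 : S != set0.
  by apply: contraNneq eN0 => S0; rewrite edge_weightE S0 big_set0.
have T0 : T != set0.
  apply: contraNneq eN0 => T0; rewrite edge_weightE T0 big1 // => u _.
  by rewrite big_set0.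
have ep : 0 < edge_weight G S T by rewrite lt_neqAle eq_sym eN0 edge_weight_ge0.
have sqrt_gt0 (X : {set V}) : X != set0 -> 0 < Num.sqrt #|X|%:R :> R.
  by move=> X0; rewrite sqrtr_gt0 ltr0n card_gt0.
pose sST := Num.sqrt #|S|%:R * Num.sqrt #|T|%:R : R.
have sST0 : 0 < sST by rewrite mulr_gt0 ?sqrt_gt0.
(* Half the actual density replaces [theta], which need not be positive. *)
pose theta' := density G S T / 2.
have theta'0 : 0 < theta' by rewrite divr_gt0 // divr_gt0.
have le_theta : theta <= theta' by rewrite /theta'; lra.
pose K0 : R := (maxn #|S| #|T|)%:R.
pose St := [set v in S | `[< exists f, growth_witness G theta' K0 v f >]].
have StS : St \subset S by apply/subsetP => v; rewrite inE => /andP[].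
exists St; split => //.
  (* Otherwise the rest of [S] carries over half the weight on no more vertices, so it has density
     at least [theta'] and contains a vertex with a witness, which belongs to [St]. *)
  rewrite leNgt; apply/negP => ltSt.
  have eB : edge_weight G S T / 2 < edge_weight G (S :\: St) T.
    by have := edge_weightID G T StS; lra.
  have B0 : S :\: St != set0.
    apply: contraTneq eB => ->.
    rewrite [edge_weight G set0 T]edge_weightE big_set0 -leNgt; lra.
  have BS : (#|S :\: St| <= #|S|)%N by rewrite subset_leq_card ?subsetDl.
  have dB : theta' <= density G (S :\: St) T.
    rewrite ler_pdivlMr ?mulr_gt0 ?sqrt_gt0 //; apply: le_trans (ltW eB).
    rewrite (edge_weight_density G S0 T0) -/sST [leRHS]mulrAC -/theta'.
    by rewrite ler_pM2l // ler_pM2r ?sqrt_gt0 // ler_wsqrtr ?ler_nat.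
  have BK : #|S :\: St|%:R <= K0 by rewrite ler_nat leq_max BS.
  have TK : #|T|%:R <= K0 by rewrite ler_nat leq_max leqnn orbT.
  have [v vB wit] := exists_growth_witness theta'0 B0 T0 BK TK dB.
  move: vB; rewrite !inE => /andP[/negP vN vS]; apply: vN.
  by rewrite vS; exact/asboolP.
move=> v K; rewrite inE => /andP[vS /asboolP[f wit]] K0K bound.
have K1 : 1 <= K.
  by apply: le_trans K0K; rewrite ler1n leq_max card_gt0 S0.
have [X [Y [XY dXY]]] := exists_dense_candidate theta'0 K1 Delta0
                           (le_growth_witness K0K wit).
have Delta1 : 1 <= (max_degree G)%:R :> R by rewrite ler1n.
have arg2 : 2 <= 16 * (max_degree G)%:R * K.
  by rewrite -mulrA; have := mulr_ege1 Delta1 K1; lra.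
set L := log2 _ in bound dXY *.
have L0 : 0 < L.
  apply: (@lt_le_trans _ _ 1) => //.
  by rewrite -[leLHS](log2_2X R 1) ler_log2 ?exprn_gt0 ?expr1.
have boundle : bound <= theta' / (8 * L).
  by rewrite ler_pM2r // invr_gt0; lra.
split; first exact: exists_local_density_output XY.
  move=> X' Y' [_ maxXY]; apply: le_trans boundle _.
  exact: le_trans dXY (maxXY _ _ XY).
move=> th0 KV.
(* [S] and [T] are disjoint and nonempty; two vertices make [log2 n] at least 1. *)
have V2 : (2 <= #|V|)%N.
  have disj : [disjoint S & T].
    rewrite disjoint_sym; apply: disjointWr SL _.
    by rewrite disjoints_subset.
  have := max_card [in S :|: T]; rewrite cardsU (disjoint_setI0 disj) cards0 subn0.
  by apply: leq_trans; rewrite -[2%N]/(1 + 1)%N leq_add ?card_gt0.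
have DV : (max_degree G <= #|V|)%N.
  by apply/bigmax_leqP => u _; exact: max_card.
have n2 : 2 <= #|V|%:R :> R by rewrite ler_nat.
have DVR : (max_degree G)%:R <= #|V|%:R :> R by rewrite ler_nat.
set n := #|V|%:R in KV n2 DVR *.
have l1 : 1 <= log2 n by rewrite -[leLHS](log2_2X R 1) ler_log2 ?exprn_gt0 ?expr1.
(* [16 Delta K <= 2^4 n^2], and [4 + 2 log n <= 6 log n]. *)
have LV : L <= 6 * log2 n.
  have : L <= log2 (2 ^+ 4 * (n * n)).
    rewrite ler_log2; [by []|lra|].
    have -> : 2 ^+ 4 = 16 :> R by rewrite -natrX.
    by rewrite -mulrA ler_pM2l // ler_pM //; lra.
  have np : 0 < n by lra.
  rewrite log2M ?exprn_gt0 ?mulr_gt0 // log2_2X log2M //; lra.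
rewrite /bound mulrCA ler_wpM2l //.
rewrite div1r -invfM lef_pV2 ?posrE; lra.
Qed.
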